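(* For every $n$ that is either a positive integer or $n=\aleph_0$, there exists a locally finite tree $T$ with $\zeta(T)=n$.
   Context: All graphs are simple, connected, and locally finite (infinite graphs are allowed, each vertex having finite degree). The Localization game on a graph $G$ with $k$ cops: the robber moves first, occupying a vertex; in each later robber move the robber moves to a neighboring vertex or stays put. On each cop move, the cops choose vertices $u_1,\dots,u_k$ (not restricted to neighbors of previous choices) and learn the distance vector $(d_1,\dots,d_k)$, where $d_i$ is the graph distance from $u_i$ to the robber's current vertex. The cops capture the robber if, after finitely many rounds, there is a unique vertex consistent with the information (i.e., the cops can determine the robber's location exactly); the robber wins by evading capture forever. The robber is omniscient (knows the cops' strategy). The localization number $\zeta(G)$ is the smallest cardinal $k$ such that $k$ cops have a winning strategy. *)

(* Defs.v *)
From mathcomp Require Import all_boot.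
From mathcomp Require Import boolp classical_sets functions cardinality.

Set Implicit Arguments.
Unset Strict Implicit.
Unset Printing Implicit Defensive.

Local Open Scope classical_set_scope.

Record graph := Graph {
  vertex :> eqType;
  adj : rel vertex;
  adj_sym : symmetric adj;
  adj_irr : irreflexive adj
}.
Arguments adj {g}.

Section Graphs.
Variable G : graph.
Implicit Types u v x y : G.

Definition walk u v (n : nat) : Prop :=
  exists p : seq G, [/\ path adj u p, last u p = v & size p = n].

Definition connected : Prop :=
  inhabited G /\ forall x y, exists n, walk x y n.

(* The bound on the size discards the 2-cycles [:: x; y] that come from
   traversing the edge xy back and forth. *)
Definition acyclic : Prop :=
  forall c : seq G, (2 < size c)%N -> ~~ ucycleb adj c.

Definition tree : Prop := connected /\ acyclic.

Definition locally_finite : Prop :=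
  forall x, finite_set [set y | adj x y].

(* The value 0 for vertices in distinct components is a dummy one. *)
Definition dist u v : nat :=
  match pselect (exists n, `[< walk u v n >]) with
  | left ex_walk => ex_minn ex_walk
  | right _ => 0
  end.

End Graphs.

Section LocalizationGame.
(* K is the index type of the cops. *)
Variables (G : graph) (K : Type).

(* r t is the position of the robber when the cops make their t-th probe. *)
Definition robber_play (r : nat -> G) : Prop :=
  forall t, r t.+1 = r t \/ adj (r t) (r t.+1).

(* The next probe, as a function of the distance vectors received so far,
   oldest first. Earlier probes are determined by these, hence not recorded. *)
Definition strategy : Type := seq (K -> nat) -> K -> G.

(* The distance vectors received during the first t rounds. *)
Fixpoint answers (s : strategy) (r : nat -> G) (t : nat) : seq (K -> nat) :=
  if t is t'.+1 then
    let h := answers s r t' in rcons h (fun i => dist (s h i) (r t'))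
  else [::].

(* Just after the t-th probe, r t is the only possible position of the robber.
   A finite play extends to an infinite one by staying put, so quantifying over
   infinite plays r' loses no possible position. *)
Definition located (s : strategy) (r : nat -> G) (t : nat) : Prop :=
  forall r', robber_play r' ->
    answers s r' t.+1 = answers s r t.+1 -> r' t = r t.

(* The robber being omniscient, s must beat every play; the number of rounds
   may depend on the play. *)
Definition winning (s : strategy) : Prop :=
  forall r, robber_play r -> exists t, located s r t.

Definition cops_win : Prop := exists s : strategy, winning s.

End LocalizationGame.

(* The localization number of G is the cardinality of K; cardinals are
   represented by types. *)
Definition localization_number_is (G : graph) (K : Type) : Prop :=
  cops_win G K /\
  forall K' : Type, cops_win G K' -> ([set: K] #<= [set: K'])%card.

(* Main.v *)
(* Take the tree in which all vertices of the same depth d have the same number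
   b d of children.

   Robber: he runs away from the root. If there are at least k g + 2 children at
   some level, the probes of k cops during the next g rounds miss the subtrees of
   two of these children, and the answers do not tell which one he went down. So
   he escapes from k cops if this occurs at every g-th level. With b d = d + 2 and
   g = 1 he escapes from any finite number of cops, starting deep enough, while
   aleph_0 cops can probe all vertices at once.

   Cops: let b d = 2 n^2 if g = 2 n + 2 divides d, and b d = 1 otherwise, so that
   n - 1 cops fail. If n cops know that the robber is below a branching vertex w,
   and how deep, they test n children of w per round; as these are the starts of
   paths of length g, each answer shows whether the robber is below the tested
   child and, if not, his depth. After at most 2 n rounds they know his child of
   w, and a probe of the root then yields his depth again, so that either he is
   located or w is replaced by a branching vertex g levels deeper. This takes
   2 n + 1 < g rounds, so the robber loses ground at each stage. Going back up to
   w does not help him, as his depth then locates him. *)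
Require Import Defs.
From mathcomp Require Import all_boot.
From mathcomp Require Import boolp classical_sets cardinality.
From mathcomp Require Import zify.

Set Implicit Arguments.
Unset Strict Implicit.
Unset Printing Implicit Defensive.

(** * Distances between words of child indices *)

(** The length of the path through the longest common prefix. It also makes sense for words that are
    not vertices, such as phantom descents. *)
Fixpoint tdist (u v : seq nat) : nat :=
  match u, v with
  | x :: u', y :: v' => if x == y then tdist u' v' else size u + size v
  | _, _ => size u + size v
  end.

Lemma tdist0s v : tdist [::] v = size v. Proof. by []. Qed.

Lemma tdist_cat w u v : tdist (w ++ u) (w ++ v) = tdist u v.
Proof. by elim: w => //= x w; rewrite eqxx. Qed.

Lemma tdistss u : tdist u u = 0.
Proof. by elim: u => //= x u; rewrite eqxx. Qed.

Lemma tdist_eq0 u v : tdist u v = 0 -> u = v.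
Proof.
elim: u v => [|x u IH] [|y v] //=.
by case: eqP => [-> /IH ->|].
Qed.

Lemma tdist_rcons u x v :
  tdist (rcons u x) v = (tdist u v).+1 \/ tdist u v = (tdist (rcons u x) v).+1.
Proof.
elim: u v => [|a u IH] [|y v] /=; rewrite ?size_rcons ?tdist0s.
- by left.
- by case: eqP => _; [right|left; lia].
- by left; lia.
- by case: eqP => _; [exact: IH|left; lia].
Qed.

Lemma tdist_split u v : exists w u' v',
  [/\ u = w ++ u', v = w ++ v' & tdist u v = size u' + size v'].
Proof.
elim: u v => [|x u IH] v; first by exists [::], [::], v.
case: v => [|y v]; first by exists [::], (x :: u), [::].
rewrite /=; case: eqP => [->|_]; last by exists [::], (x :: u), (y :: v).
have [w [u' [v' [-> -> E]]]] := IH v.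
by exists (y :: w), u', v'.
Qed.

(** The longest common prefix of [u] and [p] ends at or before position [d], so [u] has the same one
    with [p']. *)
Lemma tdist_change u p p' d :
    size p = size p' -> (forall i, i != d -> nth 0 p i = nth 0 p' i) ->
    nth 0 u d != nth 0 p d -> nth 0 u d != nth 0 p' d ->
  tdist u p = tdist u p'.
Proof.
elim: u p p' d => [|x u IH] [|y p] [|y' p'] d //=.
case=> sz E; case: d E => [|d] E /=.
  by move=> /negbTE -> /negbTE ->; rewrite sz.
move=> n1 n2; have /= <- := E 0 isT; case: eqP => _; last by rewrite sz.
by apply: (IH _ _ d) => // i ne; apply: (E i.+1).
Qed.

(** * Spherically symmetric trees *)

Section SphericalTree.
Variable b : nat -> nat.

Definition labelled (s : seq nat) : bool :=
  all (fun i => nth 0 s i < b i) (iota 0 (size s)).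

Lemma labelledP s :
  reflect (forall i, i < size s -> nth 0 s i < b i) (labelled s).
Proof.
apply: (iffP allP) => H i; first by move=> lt_i; apply: H; rewrite mem_iota.
by rewrite mem_iota => lt_i; apply: H.
Qed.

Lemma labelled_catl u v : labelled (u ++ v) -> labelled u.
Proof.
move=> /labelledP H; apply/labelledP => i lti.
by have := H i; rewrite nth_cat lti size_cat; apply; lia.
Qed.

Lemma labelled_rcons u x : labelled (rcons u x) = labelled u && (x < b (size u)).
Proof.
apply/idP/andP => [H|[/labelledP H ltx]].
  split; first by move: H; rewrite -cats1 => /labelled_catl.
  by move/labelledP/(_ (size u)): H; rewrite size_rcons nth_rcons ltnn eqxx; apply.
apply/labelledP => i; rewrite size_rcons nth_rcons ltnS leq_eqVlt.
by case: eqP => [->|_ /= lti]; [rewrite ltnn|rewrite lti; apply: H].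
Qed.

Definition node : Type := {s : seq nat | labelled s}.

Definition lab (v : node) : seq nat := val v.

Lemma labP v : labelled (lab v). Proof. exact: valP. Qed.

Lemma lab_inj : injective lab. Proof. exact: val_inj. Qed.

(** If one word extends the other by a letter, that letter is its last one; this keeps adjacency
    boolean. *)
Definition node_adj (u v : node) : bool :=
  (lab u == rcons (lab v) (last 0 (lab u))) ||
  (lab v == rcons (lab u) (last 0 (lab v))).

Lemma node_adj_sym : symmetric node_adj.
Proof. by move=> u v; rewrite /node_adj orbC. Qed.

Lemma node_adj_irr : irreflexive node_adj.
Proof.
move=> u; apply/negbTE/negP; rewrite /node_adj orbb => /eqP /(congr1 size).
by rewrite size_rcons; lia.
Qed.

Definition spherical : graph := Graph node_adj_sym node_adj_irr.


Lemma spherical_adjP (u v : spherical) :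
  reflect ((exists x, lab u = rcons (lab v) x) \/
           (exists x, lab v = rcons (lab u) x)) (adj u v).
Proof.
apply: (iffP orP) => -[].
- by move=> /eqP E; left; exists (last 0 (lab u)).
- by move=> /eqP E; right; exists (last 0 (lab v)).
- by case=> x E; left; rewrite E last_rcons.
- by case=> x E; right; rewrite E last_rcons.
Qed.

Definition Node s (s_ok : labelled s) : spherical := exist _ s s_ok.

Definition root_node : spherical := @Node [::] isT.

Lemma walk0 (u : spherical) : walk u u 0. Proof. by exists [::]. Qed.

Lemma walk_cat (u v w : spherical) m n :
  walk u v m -> walk v w n -> walk u w (m + n).
Proof.
move=> [p [pp lp <-]] [p' [pp' lp' <-]].
by exists (p ++ p'); rewrite cat_path last_cat lp pp pp' lp' size_cat.
Qed.

Lemma walk1 (u v : spherical) : adj u v -> walk u v 1.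
Proof. by move=> a; exists [:: v]; split=> //; apply/andP. Qed.

Lemma walk_sym (u v : spherical) n : walk u v n -> walk v u n.
Proof.
move=> [p]; elim: p u n => [|x p IH] u n [/=].
  by move=> _ -> <-; apply: walk0.
case/andP=> ax px lx <-; rewrite -addn1.
have {}IH := IH x _ (And3 px lx erefl).
by apply: (walk_cat IH); apply: walk1; rewrite adj_sym.
Qed.

Lemma walk_descend (u v : spherical) s : lab v = lab u ++ s -> walk u v (size s).
Proof.
elim/last_ind: s v => [|s x IH] v E.
  by rewrite cats0 in E; rewrite (lab_inj E); apply: walk0.
have ok : labelled (lab u ++ s).
  by have := labP v; rewrite E -cats1 catA => /labelled_catl.
rewrite size_rcons -addn1; have {}IH := IH (Node ok) erefl; apply: (walk_cat IH).
by apply/walk1/spherical_adjP; right; exists x; rewrite E -rcons_cat.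
Qed.

Lemma walk_tdist (u v : spherical) : walk u v (tdist (lab u) (lab v)).
Proof.
have [w [u' [v' [Eu Ev ->]]]] := tdist_split (lab u) (lab v).
have ok : labelled w by have := labP u; rewrite Eu => /labelled_catl.
apply: (@walk_cat _ (Node ok)); last exact: walk_descend.
exact/walk_sym/walk_descend.
Qed.

Lemma tdist_walk (u v : spherical) n : walk u v n -> tdist (lab u) (lab v) <= n.
Proof.
move=> [p]; elim: p u n => [|x p IH] u n [/=].
  by move=> _ -> <-; rewrite tdistss.
case/andP=> ax px lx; case: n => // n [sz]; have {IH} := IH x n (And3 px lx sz).
case/spherical_adjP: ax => -[y ->].
  by have := tdist_rcons (lab x) y (lab v); lia.
by have := tdist_rcons (lab u) y (lab v); lia.
Qed.

Lemma distE (u v : spherical) : dist u v = tdist (lab u) (lab v).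
Proof.
rewrite /dist; case: pselect => [ex|no]; last first.
  by case: no; exists (tdist (lab u) (lab v)); apply/asboolP/walk_tdist.
case: ex_minnP => m /asboolP /tdist_walk le_m /(_ _ (asboolT (walk_tdist u v))).
by lia.
Qed.

Lemma spherical_connected : connected spherical.
Proof.
by split; [exact: (inhabits root_node)|move=> u v; eexists; apply: walk_tdist].
Qed.

Lemma deepest (c : seq spherical) : c != [::] ->
  exists2 x, x \in c & forall y, y \in c -> size (lab y) <= size (lab x).
Proof.
elim: c => // a c IH _; case: (eqVneq c [::]) => [->|/IH [x xc H]].
  by exists a => [|y]; rewrite inE => // /eqP ->.
case: (leqP (size (lab a)) (size (lab x))) => le.
  exists x => [|y]; rewrite inE ?xc ?orbT // => /orP[/eqP -> //|].
  exact: H.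
exists a => [|y]; rewrite inE ?eqxx // => /orP[/eqP -> //|/H].
by move/leq_trans; apply; apply: ltnW.
Qed.

(* The two neighbours on a cycle of a deepest vertex would both be its parent. *)
Lemma spherical_acyclic : acyclic spherical.
Proof.
move=> c szc; apply/negP => /andP[cyc un].
have c0 : c != [::] by case: c szc {cyc un}.
have [x xc deep] := deepest c0.
have [i p Ep] := rot_to xc.
have parent y : y \in c -> adj x y -> exists l, lab x = rcons (lab y) l.
  move=> /deep le /spherical_adjP[//|[l E]].
  by move: le; rewrite E size_rcons; lia.
move: cyc un szc; rewrite -(rot_cycle i) -(rot_uniq i) -(size_rot i) Ep.
have memp y : y \in p -> y \in c by move=> yp; rewrite -(mem_rot i) Ep inE yp orbT.
case: p memp {Ep} => [|y p] // memp; case/lastP: p memp => [|p z] // memp.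
rewrite /= !rcons_path /= last_rcons => /and3P[axy _ azx] /and3P[_ ynz _] _.
have axz : adj x z by rewrite adj_sym.
have [||l E] := parent y => //; first by apply: memp; rewrite inE eqxx.
have [||l' E'] := parent z => //.
  by apply: memp; rewrite inE mem_rcons inE eqxx orbT.
move: E'; rewrite E => /rcons_inj [/lab_inj Eyz _].
by move: ynz; rewrite Eyz mem_rcons inE eqxx.
Qed.

Lemma spherical_tree : tree spherical.
Proof. by split; [exact: spherical_connected|exact: spherical_acyclic]. Qed.

Lemma spherical_locally_finite : locally_finite spherical.
Proof.
move=> x.
pose s := take (size (lab x)).-1 (lab x) ::
  [seq rcons (lab x) i | i <- iota 0 (b (size (lab x)))].
apply: (@sub_finite_set _ _ (lab @^-1` [set` s])%classic).
  move=> y /spherical_adjP[[l E]|[l E]]; rewrite /= !inE.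
    by rewrite E size_rcons /= -cats1 take_size_cat // eqxx.
  apply/orP; right; apply/mapP; exists l => //.
  by have := labP y; rewrite E labelled_rcons mem_iota => /andP[].
apply: finite_preimage; last exact: finite_seq.
by move=> y z _ _; apply: lab_inj.
Qed.

End SphericalTree.

(** * Escape of the robber *)

Lemma fresh (L : seq nat) N : size L < N -> exists2 c, c < N & c \notin L.
Proof.
move=> ltL; apply: contrapT => no.
suff: size (iota 0 N) <= size L by rewrite size_iota; lia.
apply: uniq_leq_size (iota_uniq _ _) _ => c; rewrite mem_iota /= => ltc.
by apply: contraT => cL; case: no; exists c.
Qed.

Section Evasion.
Variables (b : nat -> nat) (d0 g : nat) (K : eqType) (e : seq K).
Hypothesis b_gt0 : forall d, 0 < b d.
Hypothesis g_gt0 : 0 < g.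
Hypothesis b_large : forall j, g * size e + 2 <= b (d0 + j * g).
Hypothesis e_all : forall i, i \in e.
Variable s : strategy (spherical b) K.

Definition upd (f : nat -> nat) d c := fun i => if i == d then c else f i.

(* The robber following the labels f is at depth d0 + t + 1 at time t. The
   labels need not be those of actual vertices. *)
Fixpoint hist (f : nat -> nat) t : seq (K -> nat) :=
  if t is t'.+1 then
    let h := hist f t' in
    rcons h (fun i => tdist (lab (s h i)) (mkseq f (d0 + t)))
  else [::].

Lemma hist_ext f f' t :
  (forall d, d < d0 + t -> f d = f' d) -> hist f t = hist f' t.
Proof.
elim: t => //= t IH E; rewrite IH; last by move=> d ltd; apply: E; lia.
congr (rcons _ _); apply: funext => i; congr (tdist _ _).
by apply/eq_in_map => d; rewrite mem_iota /= => ltd; apply: E.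
Qed.

(* The label b d is that of a phantom child of the vertex at depth d, in which
   no probe can lie. As long as the probes answering to the robber going down
   there avoid the subtrees of the children c and c', the answers for a robber
   going down to c or c' are the same as for the phantom. *)
Lemma hist_fork f j : exists c c', let d := d0 + j * g in
  [/\ c < b d, c' < b d, c != c' &
      forall t, t <= j.+1 * g -> hist (upd f d c) t = hist (upd f d c') t].
Proof.
set d := d0 + j * g; set f0 := upd f d (b d).
(* One label per probe in the [g] rounds that start when the robber reaches depth [d + 1]; at least
   two children are left over. *)
pose L := [seq nth 0 (lab (s (hist f0 t) i)) d | t <- iota (j * g) g, i <- e].
have szL : size L + 2 <= b d.
  by rewrite size_allpairs size_iota; apply: b_large.
have phantom c : c < b d -> c \notin L ->
    forall t, t <= j.+1 * g -> hist (upd f d c) t = hist f0 t.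
  move=> ltc cL; elim=> //= t IH ltt; rewrite IH 1?ltnW //.
  congr (rcons _ _); apply: funext => i.
  case: (ltnP t (j * g)) => [ltj|lej].
    congr (tdist _ _); apply/eq_in_map => d'; rewrite mem_iota /= /upd => ltd.
    by rewrite /f0 /upd; case: eqP => // Ed; move: ltd; rewrite Ed /d; lia.
  have ltd : d < d0 + t.+1 by rewrite /d; lia.
  apply: (@tdist_change _ _ _ d); rewrite ?size_mkseq //.
  - move=> i' ne; case: (ltnP i' (d0 + t.+1)) => lt'.
      by rewrite !nth_mkseq // /f0 /upd (negbTE ne).
    by rewrite !nth_default ?size_mkseq.
  - rewrite nth_mkseq // /upd eqxx; apply: contraNN cL => /eqP <-.
    by apply/allpairsP; exists (t, i); rewrite mem_iota; split=> //=; lia.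
  - rewrite nth_mkseq // /f0 /upd eqxx.
    case: (ltnP d (size (lab (s (hist f0 t) i)))) => ltd'.
      by rewrite ltn_eqF //; apply: (labelledP _ _ (labP _)).
    (* A shorter probe has the default label 0, which is not [b d] either. *)
    by rewrite nth_default // eq_sym -lt0n.
have [|c ltc cL] := @fresh L (b d); first by lia.
have [|c' ltc'] := @fresh (c :: L) (b d); first by rewrite /=; lia.
rewrite inE negb_or => /andP[ne c'L].
exists c, c'; split=> //; first by rewrite eq_sym.
by move=> t let'; rewrite !phantom.
Qed.

(** Forks are settled one after another. The answers of the first [j.+1 * g] rounds involve only
    labels at depths below [d0 + j.+1 * g], so later forks leave earlier ones intact. *)
Lemma fork_path : exists2 f, (forall d, f d < b d) & forall j, exists c',
  let d := d0 + j * g in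
  [/\ c' < b d, c' <> f d &
      forall t, t <= j.+1 * g -> hist (upd f d c') t = hist f t].
Proof.
pose fork (x : (nat -> nat) * nat) (c : nat) := let d := d0 + x.2 * g in
  c < b d /\ exists c', [/\ c' < b d, c' != c & forall t, t <= x.2.+1 * g ->
    hist (upd x.1 d c') t = hist (upd x.1 d c) t].
have [F Fork] : {F & forall x, fork x (F x)}.
  apply: choice => -[f j]; have [c' [c [ltc' ltc ne E]]] := hist_fork f j.
  by exists c; split=> //; exists c'.
have [fs fs0 fsS] : exists2 fs : nat -> nat -> nat, fs 0 = (fun=> 0) &
    forall j, fs j.+1 = upd (fs j) (d0 + j * g) (F (fs j, j)).
  by exists (fix fs j := if j is j'.+1
    then upd (fs j') (d0 + j' * g) (F (fs j', j')) else fun=> 0).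
have fs_ok j d : fs j d < b d.
  elim: j => [|j IH]; first by rewrite fs0.
  by rewrite fsS /upd; case: eqP => // ->; have [] := Fork (fs j, j).
have fs_stable j m d : d < d0 + j * g -> fs (j + m) d = fs j d.
  move=> ltd; elim: m => [|m IH]; first by rewrite addn0.
  rewrite addnS fsS /upd; case: eqP => // Ed.
  by move: ltd; rewrite Ed mulnDl; lia.
have limE j d : d < d0 + j * g -> fs d.+1 d = fs j d.
  move=> ltd; have ltd' : d < d0 + d.+1 * g by nia.
  case: (leqP j d.+1) => [/subnKC <-|/ltnW /subnKC <-].
    exact: fs_stable.
  by rewrite fs_stable.
(* As [d < d0 + d.+1 * g], the label at depth [d] is final from stage [d.+1] on. *)
exists (fun d => fs d.+1 d) => // j.
have [_ [c' [/= ltc' /eqP ne E]]] := Fork (fs j, j).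
have nextE : fs (d0 + j * g).+1 (d0 + j * g) = F (fs j, j).
  by rewrite (limE j.+1) ?fsS /upd ?eqxx //; lia.
exists c'; split=> [||t let'] //; first by rewrite nextE.
have -> : hist (fun d => fs d.+1 d) t = hist (fs j.+1) t.
  by apply: hist_ext => d ltd; rewrite (limE j.+1) //; lia.
rewrite fsS -E //; apply: hist_ext => d ltd; rewrite /upd; case: eqP => // ne'.
by rewrite (limE j.+1) ?fsS /upd; [case: eqP|lia].
Qed.

Lemma labelled_mkseq f n : (forall d, f d < b d) -> labelled b (mkseq f n).
Proof.
by move=> f_ok; apply/labelledP => i; rewrite size_mkseq => lti; rewrite nth_mkseq.
Qed.

Definition descent f (f_ok : forall d, f d < b d) t : spherical b :=
  Node (labelled_mkseq (d0 + t.+1) f_ok).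

Lemma descent_play f (f_ok : forall d, f d < b d) : robber_play (descent f_ok).
Proof.
move=> t; right; apply/spherical_adjP; right; exists (f (d0 + t.+1)).
by rewrite /lab /= addnS mkseqS.
Qed.

Lemma answers_descent f (f_ok : forall d, f d < b d) t :
  answers s (descent f_ok) t = hist f t.
Proof.
elim: t => //= t ->; congr (rcons _ _); apply: funext => i.
by rewrite distE.
Qed.

Lemma not_winning : ~ winning s.
Proof.
have [f f_ok fork] := fork_path.
move=> /(_ _ (descent_play f_ok)) [t loc].
(* The latest fork already passed at time [t]; its two branches are still indistinguishable after
   probe [t]. *)
have [c' [ltc' ne E]] := fork (t %/ g).
have f'_ok d : upd f (d0 + t %/ g * g) c' d < b d.
  by rewrite /upd; case: eqP => // ->.
have lt_t : t < (t %/ g).+1 * g by exact: ltn_ceil.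
have /(congr1 (fun v => nth 0 (lab v) (d0 + t %/ g * g))) :
    descent f'_ok t = descent f_ok t.
  by apply: loc; [exact: descent_play|rewrite !answers_descent E].
have let' : t %/ g * g <= t by exact: leq_trunc_div.
by rewrite /lab /= !nth_mkseq ?/upd ?eqxx //; lia.
Qed.

End Evasion.

Lemma evasion (b : nat -> nat) (d0 g : nat) (K : eqType) (e : seq K) :
    (forall d, 0 < b d) -> 0 < g ->
    (forall j, g * size e + 2 <= b (d0 + j * g)) -> (forall i, i \in e) ->
  ~ cops_win (spherical b) K.
Proof.
move=> b_gt0 g_gt0 b_large e_all [s].
exact: (@not_winning b d0 g K e).
Qed.

Lemma card_le_ord_or_enum (n : nat) (K : choiceType) :
  ([set: 'I_n] #<= [set: K])%card \/
  exists2 e : seq K, size e < n & forall i, i \in e.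
Proof.
have [fin|inf] := pselect (finite_set [set: K]%classic); last first.
  left; rewrite -(card_le_eql card_II); move/infiniteP: inf; apply: card_le_trans.
  exact/subset_card_le/subsetT.
have [m Km] := fin; have [ltn|len] := ltnP m n.
  right; exists (finmap.enum_fset (fset_set [set: K])).
    by rewrite (card_fset_set Km).
  by move=> i; rewrite in_fset_set // inE.
by left; rewrite -(card_le_eql card_II) (card_le_eqr Km) card_le_II.
Qed.

(** * The search by [n] cops *)

Lemma prefix_cat_nseq0 (z : seq nat) m :
    (forall i, i < size z -> i < m -> nth 0 z i = 0) ->
  prefix (nseq m 0) z || prefix z (nseq m 0).
Proof.
elim: z m => [|a z IH] [|m] H //; rewrite ?prefix0s ?orbT //.
have /= -> := H 0 isT isT; rewrite !eqxx /=.
by apply: IH => i lti ltm; apply: (H i.+1).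
Qed.

Lemma prefix_or_size_eq (u v : seq nat) :
  prefix u v || prefix v u -> size v <= size u -> v = take (size v) u.
Proof.
case/orP=> /prefixP[z ->].
  by rewrite size_cat; case: z => [|a z] /=; [rewrite !cats0 addn0 take_size|lia].
by rewrite take_size_cat.
Qed.

Section Capture.
Variable n0 : nat.
Let n := n0.+1.
Let g := 2 * n + 2.

Definition branching (d : nat) : nat := if g %| d then 2 * n ^ 2 else 1.

Local Notation G := (spherical branching).

(* Root w: the robber is, when probed, at a prefix or at an extension of w.
   Test w D j: at the previous probe, the robber was at depth D strictly below
   w, and not under one of the first j * n children of w. *)
Inductive knowledge :=
  | Root of seq nat
  | Test of seq nat & nat & nat
  | Done.

Definition vertex_at (u : seq nat) : G := insubd (root_node branching) u.

(** Probing the children themselves would be ambiguous: a robber descending below a tested child and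
    one climbing below another could be equally far away. *)
Definition probe (k : knowledge) (i : 'I_n) : G :=
  if k is Test w _ j then vertex_at (w ++ [:: j * n + i; 0]) else root_node branching.

(** Below the tested child the distance is at most [D - size w]. At [w] it is 2. Below another
    child, at depth [D'], it is [D' - size w + 2], which is at least 3 and exceeds [D - size w]
    because [D' + 1 >= D]. *)
Definition learn (k : knowledge) (a : 'I_n -> nat) : knowledge :=
  match k with
  | Root w => if a ord0 <= size w then Done else Test w (a ord0) 0
  | Test w D j =>
      if [pick i | a i <= D - size w] is Some i
      then Root (w ++ j * n + i :: nseq g.-1 0)
      else if a ord0 <= 2 then Done else Test w (size w + a ord0 - 2) j.+1
  | Done => Done
  end.

Definition position (k : knowledge) (a : 'I_n -> nat) : seq nat :=
  match k with
  | Root w => take (a ord0) w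
  | Test w _ _ => w
  | Done => [::]
  end.

Definition search : strategy G 'I_n := fun h => probe (foldl learn (Root [::]) h).

Definition near (x y : G) := y = x \/ adj x y.

(* The rank m bounds the number of further rounds. While the cops test the
   children of w, which takes at most 2 * n rounds, and then probe the root, the
   robber gains at most 2 * n + 1 < g levels, but w goes g levels down. *)
Definition knows (m : nat) (k : knowledge) (x : G) : Prop :=
  match k with
  | Root w => exists2 N, m = N * g & [/\ g %| size w,
      prefix w (lab x) || prefix (lab x) w & size (lab x) <= size w + N]
  | Test w D j => exists2 N, m = N * g + (2 * n - j).+1 &
      exists y c z, [/\ g %| size w, near y x, lab y = w ++ c :: z,
        D = size w + (size z).+1 & D <= size w + N.+1 + j /\ j * n <= c]
  | Done => False
  end.

Lemma near_refl x : near x x. Proof. by left. Qed.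

Lemma near_below x y w c z : near y x -> lab y = w ++ c :: z ->
  (lab x = w /\ z = [::]) \/
  exists z', [/\ lab x = w ++ c :: z', size z' <= (size z).+1 & size z <= (size z').+1].
Proof.
case=> [-> E|/spherical_adjP[[l E]|[l E]] Ey].
- by right; exists z; split=> //; lia.
- rewrite Ey in E; case/lastP: z Ey E => [|z l'] Ey.
    rewrite cats1 => /rcons_inj[-> _]; by left.
  rewrite -rcons_cons -rcons_cat => /rcons_inj[<- _].
  by right; exists z; rewrite size_rcons; split=> //; lia.
- by right; exists (rcons z l); rewrite E Ey size_rcons -rcons_cons -rcons_cat; split=> //; lia.
Qed.

Lemma lab_vertex_at u : labelled branching u -> lab (vertex_at u) = u.
Proof. by move=> ok; rewrite /lab /vertex_at insubdK. Qed.

Lemma near_size (x y : G) : near x y -> size (lab y) <= (size (lab x)).+1.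
Proof.
by case=> [->//|/spherical_adjP[[l ->]|[l ->]]]; rewrite size_rcons //; lia.
Qed.

Lemma label_lt (x : G) w c z : g %| size w -> lab x = w ++ c :: z -> c < 2 * n ^ 2.
Proof.
move=> gw E; have /labelledP/(_ (size w)) := labP x.
rewrite E nth_cat ltnn subnn size_cat /= /branching gw; apply; lia.
Qed.

Lemma label0 (x : G) w c z i : g %| size w -> lab x = w ++ c :: z ->
  i < size z -> i < g.-1 -> nth 0 z i = 0.
Proof.
move=> gw E lti ltg; have /labelledP/(_ (size w + i.+1)) := labP x.
rewrite E size_cat /= ltn_add2l ltnS => /(_ lti).
rewrite nth_cat -ltn_subRL subnn ltn0 addKn /= /branching dvdn_addr // gtnNdvd //; lia.
Qed.

Lemma labelled_probe w c : labelled branching w -> g %| size w ->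
  c < 2 * n ^ 2 -> labelled branching (w ++ [:: c; 0]).
Proof.
move=> okw gw ltc; rewrite -[w ++ _](cat_rcons c w [:: 0]) cats1 !labelled_rcons okw.
by rewrite size_rcons /branching gw ltc /=; case: ifP.
Qed.

Lemma learn_knows m k x : knows m k x ->
  let a i := dist (probe k i) x in
  (learn k a = Done /\ lab x = position k a) \/
  exists2 m', m' < m & forall y, near x y -> knows m' (learn k a) y.
Proof.
case: k => [w [N mE [gw comp le]]|w D j [N mE [y [c [z [gw nyx Ey DE [leD lec]]]]]]|//] a.
  have aE i : a i = size (lab x) by rewrite /a distE.
  rewrite /= !aE; case: leqP => [le_x|lt_x].
    by left; split=> //; apply: prefix_or_size_eq.
  right; case: N mE le => [|N] mE le; first by lia.
  (* The rank drops because [2 * n + 1 < g]. *)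
  exists (N * g + (2 * n - 0).+1); first by rewrite mE mulSn /g; lia.
  move=> y nxy; exists N => //.
  case/orP: comp => /prefixP[[|c z] E]; move: lt_x; rewrite E ?cats0 ?size_cat /=; try lia.
  move=> _; exists x, c, z; split=> //.
  by split; [rewrite addn0; move: le; rewrite E size_cat /=; lia|].
have ltc : c < 2 * n ^ 2 by apply: (label_lt gw Ey).
(* From [j * n <= c < 2 * n ^ 2]: some child is still untested, and the subtraction in the rank is
   not truncated. *)
have ltj : j < 2 * n by nia.
have okw : labelled branching w by have := labP y; rewrite Ey => /labelled_catl.
have probeE i : lab (probe (Test w D j) i) = w ++ [:: j * n + i; 0].
  rewrite lab_vertex_at //; apply: labelled_probe => //.
  by have := ltn_ord i; nia.
have aE i : a i = tdist (w ++ [:: j * n + i; 0]) (lab x) by rewrite /a distE probeE.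
have [[Ex z0]|[z' [Ex le1 le2]]] := near_below nyx Ey.
  have {}aE i : a i = 2 by rewrite aE Ex -[X in tdist _ X]cats0 tdist_cat.
  left; rewrite /= aE; case: pickP => [i|_] //.
  by rewrite aE DE z0 /=; lia.
have {}aE i : a i = if j * n + i == c then tdist [:: 0] z' else 3 + size z'.
  by rewrite aE Ex tdist_cat /=; case: eqP => _ //; lia.
have a_in : tdist [:: 0] z' <= (size z).+1.
  case: z' Ex le1 le2 {aE} => [|l z'] Ex le1 le2 //=.
  have /= -> := label0 gw Ex (i := 0) isT; last by rewrite /g; lia.
  by move: le1 => /=; lia.
right; rewrite /=; case: pickP => [i|a_out].
  rewrite aE DE; case: eqP => [Ec|_]; last by lia.
  move=> _; exists (N * g); first by lia.
  move=> x' nxx'; exists N => //; rewrite Ec.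
  have sizeE : size (w ++ c :: nseq g.-1 0) = size w + g.
    by rewrite size_cat /= size_nseq /g; lia.
  rewrite sizeE; split; first by rewrite dvdn_addr.
    have [[Ex' _]|[z'' [Ex' _ _]]] := near_below nxx' Ex.
      by rewrite Ex' prefix_prefix orbT.
    rewrite Ex' !prefix_catr // !prefix_cons !eqxx; apply: prefix_cat_nseq0 => i' lti ltg.
    exact: (label0 gw Ex').
  (* The depth is now at most [D + 2 <= size w + N + j + 3], and [j + 3 <= g]. *)
  have := near_size nxx'; rewrite Ex size_cat /= /g; lia.
have lec' : j.+1 * n <= c.
  rewrite leqNgt; apply/negP => ltc'.
  have lti : c - j * n < n by rewrite mulSn in ltc'; lia.
  by have := a_out (Ordinal lti); rewrite aE [nat_of_ord _]/= subnKC // eqxx DE; lia.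
have -> : a ord0 = 3 + size z'.
  by rewrite aE ifN //; apply/eqP; rewrite /= addn0; move: lec'; rewrite mulSn /n; lia.
rewrite /=; exists (N * g + (2 * n - j.+1).+1); first by lia.
move=> x' nxx'; exists N => //; exists x, c, z'.
by split=> //; [|split=> //]; lia.
Qed.

(** The knowledge depends on the answers alone, so a play with the same answers reaches [Done] at
    the same time, and [caught] computes the same vertex for it. *)
Lemma search_wins : winning search.
Proof.
pose st h := foldl learn (Root [::]) h.
have stS r t : st (answers search r t.+1) =
    learn (st (answers search r t))
          (fun i => dist (probe (st (answers search r t)) i) (r t)).
  by rewrite /= /st foldl_rcons.
have inv r t : robber_play r -> st (answers search r t) <> Done ->
    exists m, knows m (st (answers search r t)) (r t).
  move=> play; elim: t => [_|t IH].
    (* The initial depth bounds the rank; the cops need not know it. *)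
    exists (size (lab (r 0)) * g); exists (size (lab (r 0))) => //.
    by split; rewrite ?dvdn0 ?prefix0s.
  rewrite stS; case: (pselect (st (answers search r t) = Done)) => [->//|/IH].
  move=> [m /learn_knows /= [[-> _] //|[m' _ H] _]].
  by exists m'; apply: H; case: (play t) => [->|]; [left|right].
have caught r t : robber_play r -> st (answers search r t) <> Done ->
    st (answers search r t.+1) = Done ->
    lab (r t) = position (st (answers search r t))
      (fun i => dist (probe (st (answers search r t)) i) (r t)).
  move=> play nd; rewrite stS => d; have [m] := inv r t play nd.
  move/learn_knows => /= [[_ //]|[m' _ /(_ _ (near_refl _))]].
  by rewrite d.
have loc r t : robber_play r -> st (answers search r t) <> Done ->
    st (answers search r t.+1) = Done -> located search r t.
  move=> play nd d r' play' E; apply: lab_inj.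
  have E1 : answers search r' t = answers search r t by case: (rcons_inj E).
  have E2 : (fun i => dist (probe (st (answers search r' t)) i) (r' t)) =
            (fun i => dist (probe (st (answers search r t)) i) (r t)).
    by case: (rcons_inj E).
  have := caught r' t play'; rewrite E E2 E1 => -> //; exact/esym/caught.
move=> r play.
suff H m t : knows m (st (answers search r t)) (r t) ->
    exists t', located search r t'.
  by have [|m] := inv r 0 play; [|exact: H].
elim/ltn_ind: m t => m IH t km.
have nd : st (answers search r t) <> Done by move=> E; rewrite E in km.
have /= [[d _]|[m' ltm H]] := learn_knows km.
  by exists t; apply: loc => //; rewrite stS.
apply: (IH m' ltm t.+1); rewrite stS; apply: H.
by case: (play t) => [->|]; [left|right].
Qed.

End Capture.

(** * The localization numbers *)

Lemma localization_number_branching n0 :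
  localization_number_is (spherical (branching n0)) 'I_n0.+1.
Proof.
split=> [|K win]; first by exists (@search n0); apply: search_wins.
have [//|[e lte e_all]] := @card_le_ord_or_enum n0.+1 {classic K}.
case: (@evasion (branching n0) 0 (2 * n0.+1 + 2) {classic K} e) => //.
- by move=> d; rewrite /branching; case: ifP => // _; rewrite muln_gt0 expn_gt0.
(* With [n = n0.+1] and at most [n - 1] cops, the bound is [(2 * n + 2) * (n - 1) + 2 = 2 * n ^ 2],
   the number of children. *)
- move=> j; rewrite /branching dvdn_mull // -mulnn.
  by move: (size e) lte => k; nia.
Qed.

Lemma localization_number_nat :
  localization_number_is (spherical (fun d => d.+2)) nat.
Proof.
split=> [|K win].
  (* Codes of no vertex default to the root; the cop on the robber's vertex reads 0. *)
  pose s : strategy (spherical (fun d => d.+2)) nat := fun _ i =>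
    odflt (root_node _) (unpickle i : option (node (fun d => d.+2))).
  exists s => r _; exists 0 => r' _ /= [] /(congr1 (fun f => f (pickle (r 0 : node _)))).
  rewrite /s pickleK /= !distE tdistss => /tdist_eq0 /lab_inj. by [].
apply/infiniteP => fin.
have [m Km] := fin.
have [|[e lte e_all]] := @card_le_ord_or_enum m.+1 {classic K}.
  by rewrite -(card_le_eql card_II) (card_le_eqr Km) card_le_II ltnn.
by case: (@evasion (fun d => d.+2) (size e) 1 {classic K} e) => // j;
  rewrite mul1n addn2 !ltnS leq_addr.
Qed.

Theorem theorem2p3 :
  (forall n : nat, (0 < n)%N ->
     exists T : graph,
       [/\ tree T, locally_finite T & localization_number_is T 'I_n]) /\
  (exists T : graph,
     [/\ tree T, locally_finite T & localization_number_is T nat]).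
Proof.
split=> [[//|n0] _|].
  exists (spherical (branching n0)).
  by split; [exact: spherical_tree|exact: spherical_locally_finite|
             exact: localization_number_branching].
exists (spherical (fun d => d.+2)).
by split; [exact: spherical_tree|exact: spherical_locally_finite|
           exact: localization_number_nat].
Qed.
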